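(* Let $k,m\ge1$ be integers and suppose $n>k+m$. Let $\hat X_{n,k}$ be the number of subtrees of size $k$ in the random recursive tree $\Lambda_n$. Then $$\mathrm{Cov}(\hat X_{n,k},\hat X_{n,m})=n\,\hat\sigma_{k,m},$$ where $\hat\sigma_{k,m}=\hat\sigma_{m,k}$ and $$\hat\sigma_{k,m}=-\frac{1}{k(k+1)(k+m+1)},\quad m<k,\qquad\qquad \hat\sigma_{k,k}=\frac{2k^2-1}{k(k+1)^2(2k+1)}.$$
   Context: Random recursive tree $\Lambda_n$: start with a root labelled $1$; for $i=2,\dots,n$, node $i$ is attached as a child of a uniformly random node among $1,\dots,i-1$ (independently of earlier choices). The size of a tree is its number of nodes. A subtree always means a fringe subtree: a node together with all its descendants. *)

(* Defs.v *)
From HB Require Import structures.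
From mathcomp Require Import all_boot all_order all_algebra.
From mathcomp Require Import all_classical all_reals all_analysis.

Set Implicit Arguments.
Unset Strict Implicit.
Unset Printing Implicit Defensive.

Import Order.TTheory GRing.Theory Num.Theory.

Local Open Scope classical_set_scope.
Local Open Scope ring_scope.

(* The node labelled i + 1 is represented by i : 'I_n, so the root is 0.  A tree
   is given by c : 'I_n -> nat, where c i is the parent of the non-root node i;
   the value c 0 is ignored. *)

Definition child_of n (c : 'I_n -> nat) : rel 'I_n :=
  [rel u v : 'I_n | (0 < u)%N && (c u == v)].

Definition fringe_subtree n (c : 'I_n -> nat) (v : 'I_n) : {set 'I_n} :=
  [set u | connect (child_of c) u v]%SET.

Definition num_subtrees n (c : 'I_n -> nat) (k : nat) : nat :=
  #|[set v | #|fringe_subtree c v| == k]%SET|.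

(* Mutual independence of the subfamily of X indexed by D. *)
Definition mutually_independent d d' (T : measurableType d)
    (T' : measurableType d') (R : realType) (P : probability T R)
    (I : finType) (D : {set I}) (X : I -> {RV P >-> T'}) : Prop :=
  forall (J : {set I}) (A : I -> set T'),
    J \subset D -> (forall i, measurable (A i)) ->
    P (\bigcap_(i in [set` J]) (X i @^-1` A i)) =
    (\prod_(i in J) P (X i @^-1` A i))%E.

(* c i is the parent of the non-root node i; it is uniform on {0, ..., i - 1},
   i.e. on the nodes labelled 1, ..., i when node i is labelled i + 1. *)
Definition random_recursive_tree d (T : measurableType d) (R : realType)
    (P : probability T R) n (c : 'I_n -> {RV P >-> nat}) : Prop :=
  (forall i j : 'I_n, (j < i)%N ->
     P (c i @^-1` [set (j : nat)]) = (i%:R^-1)%:E) /\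
  mutually_independent [set i : 'I_n | (0 < i)%N]%SET c.

Definition subtree_count d (T : measurableType d) (R : realType)
    (P : probability T R) n (c : 'I_n -> {RV P >-> nat}) (k : nat) : T -> R :=
  fun w => (num_subtrees (fun i => c i w) k)%:R.

Definition sigma_hat_gt (R : realType) (k m : nat) : R :=
  - (1 / (k%:R * (k%:R + 1) * (k%:R + m%:R + 1))).

Definition sigma_hat (R : realType) (k m : nat) : R :=
  if (m < k)%N then sigma_hat_gt R k m
  else if (k < m)%N then sigma_hat_gt R m k
  else (2 * k%:R ^+ 2 - 1) / (k%:R * (k%:R + 1) ^+ 2 * (2 * k%:R + 1)).

(* Main.v *)
Require Import Defs.
From HB Require Import structures.
From mathcomp Require Import all_boot all_order all_algebra.
From mathcomp Require Import all_classical all_reals all_analysis.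
From mathcomp Require Import measurable_realfun.
From mathcomp Require Import zify ring.

(** Grow the tree one node at a time.  A new node whose parent is [j] becomes a
    subtree of size 1 and adds 1 to the size of the subtree at [j] and at every
    ancestor of [j].  Two distinct subtrees of equal size are disjoint, so
    at most one of the enlarged subtrees had size [k].  Write [A_k(j)] for the
    indicator that [j] lies in a subtree of size [k], with [A_0 = 1] accounting
    for the new leaf, and [Y_k] for the sum of [A_k] over all nodes, which is
    [k X_k] for [k > 0] and the number of nodes for [k = 0].  Then

      [Y'_{k+1} = Y_{k+1} + (k+1) (A_k(j) - A_{k+1}(j))]   ([nb_covered_insert])

    without any special case for leaves, where primes refer to the enlarged tree.

    Averaging over the [n] equally likely choices of [j] gives linear recurrences
    in [n] for [E Y_k] and [E (Y_a Y_b)].  The square of the increment brings in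
    the number [W_{a,b}] of nodes that lie both in a subtree of size [a] and in
    one of size [b].  For [a < b] these subtrees are nested, and [E W_{a,b}]
    satisfies a recurrence of its own ([sum_nb_covered2_insert]).  The solutions
    are [E Y_k = n / (k+1)] for [n > k], [E W_{a,b} = n / ((a+1)(b+1))] for
    [a < b < n], and [E (Y_a Y_b) = n^2 / ((a+1)(b+1)) + n cov_covered(a, b)] for
    [n > a + b].  No initial condition is needed: in the step from [n] to
    [n + 1] the unknown itself has a coefficient, for instance [n - a - b] for
    [E (Y_a Y_b)], that vanishes at the largest [n] outside the stated range.  After the terms in
    [n^2] cancel, the last claim is an identity between rational functions
    ([cov_covered_rec]).

    These computations take place in the uniform distribution on the finite list
    [recursive_trees].  By independence the parents of the non-root nodes are
    equal to a given recursive tree with probability [1 / (n-1)!], so the two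
    expectations coincide ([expectation_parent_seq]). *)

Set Implicit Arguments.
Unset Strict Implicit.
Unset Printing Implicit Defensive.

Import Order.TTheory GRing.Theory Num.Theory.

Local Open Scope ring_scope.

(** * Ancestors and subtree sizes *)

(** A tree is given by the parent of each node; truncated subtraction makes the
    root [0] its own parent, so that the function is total and its iterates
    enumerate the ancestors. *)
Definition parent_function (p : nat -> nat) := forall i, (p i <= i.-1)%N.

(** [u.+1] iterates are enough: node [u] has depth at most [u]. *)
Definition ancestor (p : nat -> nat) (u v : nat) : bool := v \in traject p u u.+1.

Definition subtree_size (p : nat -> nat) (n v : nat) : nat :=
  (\sum_(u < n) ancestor p u v)%N.

(** The value at [k = 0] is the convention [A_0 = 1] that lets a new leaf count as
    a subtree grown from size 0. *)
Definition in_subtree (p : nat -> nat) (n k u : nat) : bool :=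
  (k == 0%N) || [exists v : 'I_n, ancestor p u v && (subtree_size p n v == k)].

Lemma parent_function_iter_leq p (hp : parent_function p) i u :
  (iter i p u <= u - i)%N.
Proof.
elim: i => [|i IH]; first by rewrite subn0.
by rewrite iterS; apply: leq_trans (hp _) _; rewrite subnS -!subn1 leq_sub2r.
Qed.

Lemma ancestorP p (hp : parent_function p) u v :
  reflect (exists i, v = iter i p u) (ancestor p u v).
Proof.
apply: (iffP trajectP) => [[i _ ->]|[i ->]]; first by exists i.
have [le_iu|lt_ui] := leqP i u; first by exists i.
exists u => //; have := parent_function_iter_leq hp i u.
have := parent_function_iter_leq hp u u; rewrite subnn leqn0 => /eqP->.
by move/ltnW: lt_ui; rewrite -subn_eq0 => /eqP->; rewrite leqn0 => /eqP.
Qed.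

Lemma ancestor_refl p u : ancestor p u u.
Proof. by rewrite /ancestor /= inE eqxx. Qed.

Lemma ancestor_leq p (hp : parent_function p) u v : ancestor p u v -> (v <= u)%N.
Proof.
move=> /(ancestorP hp)[i ->].
by apply: leq_trans (parent_function_iter_leq hp i u) (leq_subr _ _).
Qed.

Lemma ancestor_trans p (hp : parent_function p) u v w :
  ancestor p u v -> ancestor p v w -> ancestor p u w.
Proof.
move=> /(ancestorP hp)[i ->] /(ancestorP hp)[j ->].
by apply/(ancestorP hp); exists (j + i)%N; rewrite iterD.
Qed.

Lemma ancestor_chain p (hp : parent_function p) w u v :
  ancestor p w u -> ancestor p w v -> ancestor p u v || ancestor p v u.
Proof.
move=> /(ancestorP hp)[i ->] /(ancestorP hp)[j ->].
have [le_ij|/ltnW le_ji] := leqP i j; apply/orP; [left|right].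
  by apply/(ancestorP hp); exists (j - i)%N; rewrite -iterD subnK.
by apply/(ancestorP hp); exists (i - j)%N; rewrite -iterD subnK.
Qed.

Lemma ancestor_step p (hp : parent_function p) u v :
  ancestor p u v = (u == v) || ancestor p (p u) v.
Proof.
apply/(ancestorP hp)/orP => [[[|i] ->]|[/eqP <-|/(ancestorP hp)[i ->]]].
- by left; rewrite /= eqxx.
- by right; apply/(ancestorP hp); exists i; rewrite iterSr.
- by exists 0%N.
- by exists i.+1; rewrite iterSr.
Qed.

Lemma ancestor_parent p (hp : parent_function p) u v :
  (v < u)%N -> ancestor p u v = ancestor p (p u) v.
Proof. by move=> lt_vu; rewrite ancestor_step // gtn_eqF. Qed.

Lemma eq_ancestor p q n (hp : parent_function p) (hq : parent_function q) u v :
  (forall i, (i < n)%N -> q i = p i) -> (u < n)%N ->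
  ancestor q u v = ancestor p u v.
Proof.
move=> pq; elim/ltn_ind: u => u IH lt_un.
rewrite [RHS]ancestor_step // ancestor_step // pq //.
case: u IH lt_un => [|u] IH lt_un.
  by have /eqP-> : p 0%N == 0%N by rewrite -leqn0 hp.
have lt_pu : (p u.+1 < u.+1)%N by rewrite ltnS hp.
by rewrite IH // (ltn_trans lt_pu).
Qed.

Lemma subtree_size_gt0 p n v : (v < n)%N -> (0 < subtree_size p n v)%N.
Proof.
by move=> lt_vn; rewrite /subtree_size (bigD1 (Ordinal lt_vn)) //= ancestor_refl.
Qed.

Lemma leq_subtree_size p n (hp : parent_function p) u v :
  ancestor p u v -> (subtree_size p n u <= subtree_size p n v)%N.
Proof.
move=> uv; apply: leq_sum => w _.
by case wu : (ancestor p w u) => //; rewrite (ancestor_trans hp wu uv).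
Qed.

(** A proper ancestor [v] of [u] counts itself in addition to the descendants of
    [u]. *)
Lemma eq_subtree_size p n (hp : parent_function p) u v :
  (v < n)%N -> ancestor p u v -> subtree_size p n u = subtree_size p n v -> u = v.
Proof.
move=> lt_vn uv; have := ancestor_leq hp uv.
rewrite leq_eqVlt => /predU1P[-> // | lt_vu] /eqP.
rewrite ltn_eqF // /subtree_size [ltnLHS](bigD1 (Ordinal lt_vn)) // [ltnRHS](bigD1 (Ordinal lt_vn)) //=.
rewrite ancestor_refl; have [vu|_] := boolP (ancestor p v u).
  by move: (ancestor_leq hp vu); rewrite leqNgt lt_vu.
rewrite add0n add1n ltnS; apply: leq_sum => w _.
by case wu : (ancestor p w u) => //; rewrite (ancestor_trans hp wu uv).
Qed.

(** Ancestors of one node form a chain, along which sizes strictly increase.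
    This makes subtrees of equal size disjoint. *)
Lemma eq_subtree_of_size p n (hp : parent_function p) w u v :
  (u < n)%N -> (v < n)%N -> ancestor p w u -> ancestor p w v ->
  subtree_size p n u = subtree_size p n v -> u = v.
Proof.
move=> lt_un lt_vn wu wv eq_uv.
have /orP[uv|vu] := ancestor_chain hp wu wv; first exact: eq_subtree_size eq_uv.
by apply/esym/(eq_subtree_size hp lt_un vu).
Qed.

(** * Counts of subtrees and of the nodes they cover *)

Section Counting.
Context (R : comNzRingType).

Definition nb_subtrees p n k : R := \sum_(v < n) (subtree_size p n v == k)%:R.
Definition nb_covered p n k : R := \sum_(u < n) (in_subtree p n k u)%:R.
Definition nb_covered2 p n a b : R :=
  \sum_(u < n) (in_subtree p n a u && in_subtree p n b u)%:R.
Definition nb_nested p n a b : R :=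
  \sum_(v < n) \sum_(u < n)
   [&& ancestor p u v, subtree_size p n u == a & subtree_size p n v == b]%:R.

Lemma in_subtreeE p n k u (hp : parent_function p) : (0 < k)%N ->
  (in_subtree p n k u)%:R =
  \sum_(v < n) (ancestor p u v && (subtree_size p n v == k))%:R :> R.
Proof.
move=> k_gt0; rewrite /in_subtree gtn_eqF //=.
case: existsP => [[v /andP[uv /eqP szv]]|no_v].
  rewrite (bigD1 v) //= uv szv eqxx big1 ?addr0 // => w neq_wv.
  case: andP => // -[uw /eqP szw]; case/eqP: neq_wv; apply/val_inj.
  by apply: (eq_subtree_of_size (n := n) hp _ _ uw uv); rewrite ?ltn_ord ?szv.
rewrite big1 // => v _; case uv : (_ && _) => //.
by case: no_v; exists v.
Qed.

Lemma nb_covered0 p n : nb_covered p n 0 = n%:R.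
Proof. by rewrite /nb_covered sumr_const card_ord. Qed.

Lemma nb_covered2_0 p n b : nb_covered2 p n 0 b = nb_covered p n b.
Proof. by []. Qed.

Lemma nb_covered2C p n a b : nb_covered2 p n a b = nb_covered2 p n b a.
Proof. by apply: eq_bigr => u _; rewrite andbC. Qed.

Lemma nb_covered2_diag p n a : nb_covered2 p n a a = nb_covered p n a.
Proof. by apply: eq_bigr => u _; rewrite andbb. Qed.

Lemma sum_ancestor p n v : \sum_(u < n) (ancestor p u v)%:R = (subtree_size p n v)%:R :> R.
Proof. by rewrite natr_sum. Qed.

Lemma nb_covered_subtrees p n k (hp : parent_function p) : (0 < k)%N ->
  nb_covered p n k = k%:R * nb_subtrees p n k.
Proof.
move=> k_gt0; rewrite /nb_covered; under eq_bigr do rewrite in_subtreeE //.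
rewrite exchange_big mulr_sumr; apply: eq_bigr => v _ /=.
have [<-|_] := eqVneq; last by rewrite mulr0 big1 // => u _; rewrite andbF.
by rewrite mulr1 -sum_ancestor; apply: eq_bigr => u _; rewrite andbT.
Qed.

(** A node in subtrees of sizes [a < b] determines these subtrees, which are
    nested; each nested pair is counted once for every node of the smaller one. *)
Lemma nb_covered2_nested p n a b (hp : parent_function p) : (0 < a < b)%N ->
  nb_covered2 p n a b = a%:R * nb_nested p n a b.
Proof.
case/andP=> a_gt0 lt_ab; have b_gt0 := ltn_trans a_gt0 lt_ab.
rewrite /nb_covered2.
under eq_bigr => w _ do rewrite -mulnb natrM !in_subtreeE // mulr_sumr.
rewrite exchange_big mulr_sumr; apply: eq_bigr => v _ /=.
under eq_bigr => w _ do rewrite mulr_suml.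
rewrite exchange_big mulr_sumr; apply: eq_bigr => u _ /=.
have [szu|_] := eqVneq (subtree_size p n u) a; last first.
  by rewrite andbF mulr0 big1 // => w _; rewrite andbF mul0r.
have [szv|_] := eqVneq (subtree_size p n v) b; last first.
  by rewrite !andbF mulr0 big1 // => w _; rewrite andbF mulr0.
rewrite !andbT -szu -sum_ancestor mulr_suml; apply: eq_bigr => w _.
rewrite !andbT -!natrM !mulnb; congr (_%:R); congr nat_of_bool.
case wu : (ancestor p w u) => //=; apply/idP/idP => [wv|uv].
  have /orP[//|vu] := ancestor_chain hp wu wv.
  by have := leq_subtree_size n hp vu; rewrite szu szv leqNgt lt_ab.
exact: ancestor_trans wu uv.
Qed.

(** * Insertion of a node *)

Section Insertion.
Context (p q : nat -> nat) (n j : nat).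
Hypotheses (hp : parent_function p) (hq : parent_function q).
Hypotheses (pq : forall i, (i < n)%N -> q i = p i) (qn : q n = j) (lt_jn : (j < n)%N).

Lemma subtree_size_insert v : (v < n)%N ->
  subtree_size q n.+1 v = (subtree_size p n v + ancestor p j v)%N.
Proof.
move=> lt_vn; rewrite /subtree_size big_ord_recr /=.
rewrite ancestor_parent // qn (eq_ancestor hp hq _ pq) //; congr (_ + _)%N.
by apply: eq_bigr => u _; rewrite (eq_ancestor hp hq _ pq).
Qed.

Lemma subtree_size_new : subtree_size q n.+1 n = 1%N.
Proof.
rewrite /subtree_size big_ord_recr /= ancestor_refl big1 // => u _.
case un : (ancestor q u n) => //.
by have := ancestor_leq hq un; rewrite leqNgt ltn_ord.
Qed.

(** At most one subtree containing [j] has size [k], and at most one has size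
    [k.+1]: the first enters the count and the second leaves it. *)
Lemma nb_subtrees_insert k :
  nb_subtrees q n.+1 k.+1 =
  nb_subtrees p n k.+1 + (in_subtree p n k j)%:R - (in_subtree p n k.+1 j)%:R.
Proof.
rewrite /nb_subtrees big_ord_recr /= subtree_size_new eqSS.
have -> : \sum_(v < n) (subtree_size q n.+1 v == k.+1)%:R =
  \sum_(v < n) ((subtree_size p n v == k.+1)%:R
    - (ancestor p j v && (subtree_size p n v == k.+1))%:R
    + (ancestor p j v && (subtree_size p n v == k))%:R) :> R.
  apply: eq_bigr => v _; rewrite subtree_size_insert //.
  by case: ancestor; rewrite ?addn1 ?addn0 ?eqSS ?subrr ?add0r ?subr0 ?addr0.
rewrite big_split sumrB /= -in_subtreeE //.
(* No old subtree has size 0; for k = 0 the gain is the new leaf itself. *)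
case: k => [|k]; last by rewrite -in_subtreeE // mulr0n addr0 addrAC.
rewrite [X in _ + X + _ = _]big1 ?addr0 /=; first by rewrite addrAC.
by move=> v _; rewrite gtn_eqF ?andbF // subtree_size_gt0.
Qed.

Lemma nb_covered_insert k :
  nb_covered q n.+1 k.+1 = nb_covered p n k.+1 +
   k.+1%:R * ((in_subtree p n k j)%:R - (in_subtree p n k.+1 j)%:R).
Proof. by rewrite !nb_covered_subtrees // nb_subtrees_insert; ring. Qed.

End Insertion.

(** A nested pair [u], [v] of subtrees gets sizes [a.+1], [b.+1] in three ways,
    according to the place of the new parent [j]: outside [v] (the sizes were
    right and [n - b.+1] nodes qualify), in [v] but not in [u] ([v] had size [b],
    leaving [b - a.+1] nodes), or in [u] (sizes [a] and [b], with [a] nodes).  For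
    [a = 0] the inner subtree may also be the new leaf, which completes the last
    term since every node lies in a subtree of size 0. *)
Lemma sum_nb_covered2_insert p n (q : nat -> nat -> nat) a b :
  parent_function p -> (forall j, (j < n)%N -> parent_function (q j)) ->
  (forall j i, (i < n)%N -> q j i = p i) -> (forall j, q j n = j) -> (a < b)%N ->
  \sum_(j < n) nb_covered2 (q j) n.+1 a.+1 b.+1 =
  (n%:R - b.+1%:R) * nb_covered2 p n a.+1 b.+1
  + (b%:R - a.+1%:R) * nb_covered2 p n a.+1 b + a.+1%:R * nb_covered2 p n a b.
Proof.
move=> hp hq pq qn lt_ab; have b_gt0 : (0 < b)%N by case: b lt_ab.
have step (j : 'I_n) : nb_nested (q j) n.+1 a.+1 b.+1 =
  \sum_(v < n) \sum_(u < n) ([&& ancestor p u v, subtree_size p n u == a.+1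
      & subtree_size p n v == b.+1]%:R * (1 - (ancestor p j v)%:R)
    + [&& ancestor p u v, subtree_size p n u == a.+1
      & subtree_size p n v == b]%:R * ((ancestor p j v)%:R - (ancestor p j u)%:R)
    + [&& ancestor p u v, subtree_size p n u == a
      & subtree_size p n v == b]%:R * (ancestor p j u)%:R)
  + (a == 0)%:R * (in_subtree p n b j)%:R.
  have hqj := hq j (ltn_ord j).
  rewrite /nb_nested big_ord_recr /= [X in _ + X]big1 ?addr0; last first.
    by move=> u _; rewrite subtree_size_new // eqSS (ltn_eqF b_gt0) !andbF.
  rewrite in_subtreeE // mulr_sumr -big_split; apply: eq_bigr => v _ /=.
  rewrite big_ord_recr /= subtree_size_new // ancestor_parent // qn.
  rewrite (subtree_size_insert hp hqj (pq j) (qn j)) //.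
  congr (_ + _); last first.
    rewrite (eq_ancestor hp hqj _ (pq j)) // eqSS eq_sym.
    case: (ancestor p j v) => /=; last by rewrite mulr0.
    by rewrite addn1 eqSS -natrM mulnb.
  apply: eq_bigr => u _; rewrite (subtree_size_insert hp hqj (pq j) (qn j)) //.
  rewrite (eq_ancestor hp hqj _ (pq j)) //.
  case uv: (ancestor p u v) => /=; last by rewrite !mul0r !addr0.
  case ju: (ancestor p j u).
    rewrite (ancestor_trans hp ju uv) !addn1 !eqSS /=; ring.
  by case: (ancestor p j v); rewrite ?addn1 ?addn0 ?eqSS /=; ring.
under eq_bigr => j _ do
  rewrite (nb_covered2_nested _ (hq j (ltn_ord j))) ?ltnS // step.
rewrite -mulr_sumr big_split /= -mulr_sumr exchange_big /=.
under eq_bigr => v _ do rewrite exchange_big /=.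
have -> : \sum_(v < n) \sum_(u < n) \sum_(j < n)
    ([&& ancestor p u v, subtree_size p n u == a.+1
      & subtree_size p n v == b.+1]%:R * (1 - (ancestor p j v)%:R)
    + [&& ancestor p u v, subtree_size p n u == a.+1
      & subtree_size p n v == b]%:R * ((ancestor p j v)%:R - (ancestor p j u)%:R)
    + [&& ancestor p u v, subtree_size p n u == a
      & subtree_size p n v == b]%:R * (ancestor p j u)%:R) =
  (n%:R - b.+1%:R) * nb_nested p n a.+1 b.+1
  + (b%:R - a.+1%:R) * nb_nested p n a.+1 b + a%:R * nb_nested p n a b.
  rewrite /nb_nested !mulr_sumr -!big_split; apply: eq_bigr => v _ /=.
  rewrite !mulr_sumr -!big_split; apply: eq_bigr => u _ /=.
  rewrite !big_split /= -!mulr_sumr !sumrB !sum_ancestor sumr_const card_ord.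
  case: (ancestor p u v) => /=; last by rewrite !(mulr0, mul0r).
  have [->|_] := eqVneq (subtree_size p n v) b.
    rewrite [b == b.+1]ltn_eqF // !andbF !andbT !(mulr0, mul0r).
    do 2![case: eqVneq => [->|_]]; rewrite ?(mulr0, mul0r, mulr1, mul1r) //.
  have [->|_] := eqVneq (subtree_size p n v) b.+1; last first.
    by rewrite !andbF !(mulr0, mul0r).
  by case: eqVneq; rewrite !(andbF, mulr0, mul0r, addr0, mulr1, mul1r).
have nest x y : (x < y)%N -> nb_covered2 p n x.+1 y.+1 = x.+1%:R * nb_nested p n x.+1 y.+1.
  by move=> lt_xy; rewrite nb_covered2_nested.
rewrite nest //.
(* For b = a.+1 the two sizes agree and nothing nests, but the factor is 0. *)
have -> : (b%:R - a.+1%:R) * nb_covered2 p n a.+1 b =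
          (b%:R - a.+1%:R) * (a.+1%:R * nb_nested p n a.+1 b).
  move: lt_ab; rewrite leq_eqVlt => /predU1P[<-|lt_ab]; first by rewrite subrr !mul0r.
  by rewrite nb_covered2_nested.
rewrite -[\sum_(j < n) _]/(nb_covered p n b).
case: a lt_ab {step nest} => [|a] lt_ab; first by rewrite nb_covered2_0 /=; ring.
by rewrite nb_covered2_nested ?(ltnW lt_ab) // /=; ring.
Qed.
End Counting.

(** * The uniform distribution on recursive trees *)

(** The list gives the parents of the nodes [1], [2], ...; the extra head
    is the root as its own parent. *)
Definition parent (s : seq nat) : nat -> nat := nth 0%N (0%N :: s).

Fixpoint recursive_trees (m : nat) : seq (seq nat) :=
  if m is m'.+1 then [seq rcons s j | s <- recursive_trees m', j <- iota 0 m]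
  else [:: [::]].

Lemma recursive_treesP m s :
  reflect (size s = m /\ forall i, (i < m)%N -> (nth 0%N s i <= i)%N)
    (s \in recursive_trees m).
Proof.
elim: m s => [|m IH] s.
  by rewrite inE; apply: (iffP eqP) => [->|[/size0nil]].
apply: (iffP allpairsP) => [[[t j] []]|[]].
  move=> /IH[szt le_t]; rewrite (mem_iota 0 m.+1) => /= lt_jm ->.
  split=> [|i lt_im]; first by rewrite size_rcons szt.
  rewrite nth_rcons szt; case: ltngtP => [/le_t // | | ->]; last by rewrite -ltnS.
  by rewrite ltnNge -ltnS lt_im.
case/lastP: s => // s j; rewrite size_rcons => -[szs] le_s.
exists (s, j); split=> //; last first.
  rewrite (mem_iota 0 m.+1) /= add0n ltnS.
  by have := le_s m (ltnSn m); rewrite nth_rcons szs ltnn eqxx.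
apply/IH; split=> [|i lt_im]; first by case: szs.
by have := le_s i (ltnW lt_im); rewrite nth_rcons; case: szs => ->; rewrite lt_im.
Qed.

Lemma recursive_trees_uniq m : uniq (recursive_trees m).
Proof.
elim: m => // m IH; apply: (allpairs_uniq IH (iota_uniq 0 m.+1)).
by move=> [s j] [t k] _ _ /= /rcons_inj[-> ->].
Qed.

Lemma size_recursive_trees m : size (recursive_trees m) = m`!.
Proof. by elim: m => // m IH; rewrite (size_allpairs _ _ (iota 0 m.+1)) IH size_iota factS mulnC. Qed.

Lemma parent_recursive_tree m s : s \in recursive_trees m -> parent_function (parent s).
Proof.
move=> /recursive_treesP[szs le_s] [|i] //=; rewrite /parent /=.
by have [/le_s //|le_mi] := ltnP i m; rewrite nth_default ?szs.
Qed.

Lemma parent_rcons_old m s j i : size s = m -> (i < m.+1)%N ->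
  parent (rcons s j) i = parent s i.
Proof. by move=> szs; case: i => //= i lt_im; rewrite /parent /= nth_rcons szs -ltnS lt_im. Qed.

Lemma parent_rcons_new m s j : size s = m -> parent (rcons s j) m.+1 = j.
Proof. by move=> szs; rewrite /parent /= nth_rcons szs ltnn eqxx. Qed.

(** * Recurrences for the mean values *)

Section Mean.
Context (R : numFieldType).
Implicit Types (F G : seq nat -> R).

Definition tree_mean m F : R := (m`!%:R)^-1 * \sum_(s <- recursive_trees m) F s.

Lemma eq_tree_mean m F G : {in recursive_trees m, F =1 G} -> tree_mean m F = tree_mean m G.
Proof. by move=> FG; congr (_ * _); apply: eq_big_seq. Qed.

Lemma tree_meanD m F G : tree_mean m (fun s => F s + G s) = tree_mean m F + tree_mean m G.
Proof. by rewrite /tree_mean big_split mulrDr. Qed.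

Lemma tree_meanZ m c F : tree_mean m (fun s => c * F s) = c * tree_mean m F.
Proof. by rewrite /tree_mean -mulr_sumr mulrCA. Qed.

Lemma tree_meanB m F G : tree_mean m (fun s => F s - G s) = tree_mean m F - tree_mean m G.
Proof. by rewrite /tree_mean sumrB mulrBr. Qed.

Lemma tree_mean_cst m c : tree_mean m (fun=> c) = c.
Proof.
rewrite /tree_mean big_const_seq count_predT size_recursive_trees iter_addr_0.
by rewrite -[c *+ _]mulr_natl mulKf // pnatr_eq0 -lt0n fact_gt0.
Qed.

(** The last node chooses its parent uniformly, whatever the tree before it. *)
Lemma tree_meanS m F :
  tree_mean m.+1 F = m.+1%:R^-1 * tree_mean m (fun s => \sum_(j < m.+1) F (rcons s j)).
Proof.
rewrite /tree_mean factS natrM invfM -mulrA; congr (_ * (_ * _)).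
rewrite (big_allpairs_dep (r2 := fun=> iota 0 m.+1)); apply: eq_bigr => s _.
by rewrite -[iota 0 m.+1]/(index_iota 0 m.+1) big_mkord.
Qed.

Definition mean_covered m k : R := tree_mean m (fun s => nb_covered R (parent s) m.+1 k).
Definition mean_covered2 m a b : R :=
  tree_mean m (fun s => nb_covered2 R (parent s) m.+1 a b).
Definition mean_coveredM m a b : R :=
  tree_mean m (fun s => nb_covered R (parent s) m.+1 a * nb_covered R (parent s) m.+1 b).

Lemma nb_covered_rcons m s j k : s \in recursive_trees m -> (j < m.+1)%N ->
  nb_covered R (parent (rcons s j)) m.+2 k.+1 = nb_covered R (parent s) m.+1 k.+1 +
   k.+1%:R * ((in_subtree (parent s) m.+1 k j)%:R - (in_subtree (parent s) m.+1 k.+1 j)%:R).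
Proof.
move=> sm lt_jm; have [szs _] := recursive_treesP _ _ sm.
have sjm : rcons s j \in recursive_trees m.+1.
  by apply/allpairsP; exists (s, j); rewrite (mem_iota 0 m.+1).
apply: nb_covered_insert => //.
- exact: parent_recursive_tree sm.
- exact: parent_recursive_tree sjm.
- by move=> i; apply: parent_rcons_old.
- exact: parent_rcons_new.
Qed.

Lemma mean_coveredS m k :
  mean_covered m.+1 k.+1 =
  m.+1%:R^-1 * ((m.+1%:R - k.+1%:R) * mean_covered m k.+1 + k.+1%:R * mean_covered m k).
Proof.
rewrite /mean_covered -!tree_meanZ -tree_meanD -tree_meanZ.
rewrite tree_meanS -tree_meanZ; apply: eq_tree_mean => s sm; congr (_ * _).
under eq_bigr => j _ do rewrite nb_covered_rcons //.
rewrite big_split -mulr_sumr sumrB /= sumr_const card_ord -mulr_natl.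
by rewrite -!/(nb_covered R (parent s) m.+1 _); ring.
Qed.

Lemma mean_covered2S m a b : (a < b)%N ->
  mean_covered2 m.+1 a.+1 b.+1 =
  m.+1%:R^-1 * ((m.+1%:R - b.+1%:R) * mean_covered2 m a.+1 b.+1
   + (b%:R - a.+1%:R) * mean_covered2 m a.+1 b + a.+1%:R * mean_covered2 m a b).
Proof.
move=> lt_ab; rewrite /mean_covered2 -!tree_meanZ -!tree_meanD -tree_meanZ.
rewrite tree_meanS -tree_meanZ; apply: eq_tree_mean => s sm; congr (_ * _).
have [szs _] := recursive_treesP _ _ sm.
apply: (@sum_nb_covered2_insert R _ _ (fun j => parent (rcons s j))) => //.
- exact: parent_recursive_tree sm.
- move=> j lt_jm; apply: (parent_recursive_tree (m := m.+1)).
  by apply/allpairsP; exists (s, j); rewrite (mem_iota 0 m.+1).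
- by move=> j i; apply: parent_rcons_old.
- by move=> j; apply: parent_rcons_new.
Qed.

(** The product of the two increments contributes the [mean_covered2] terms, as
    [A_a A_b] is the indicator of lying in subtrees of both sizes. *)
Lemma mean_coveredMS m a b :
  mean_coveredM m.+1 a.+1 b.+1 =
  m.+1%:R^-1 * ((m.+1%:R - a.+1%:R - b.+1%:R) * mean_coveredM m a.+1 b.+1
   + a.+1%:R * mean_coveredM m a b.+1 + b.+1%:R * mean_coveredM m a.+1 b
   + a.+1%:R * b.+1%:R * (mean_covered2 m a b - mean_covered2 m a b.+1
                          - mean_covered2 m a.+1 b + mean_covered2 m a.+1 b.+1)).
Proof.
rewrite /mean_covered2 /mean_coveredM -!(tree_meanZ, tree_meanD, tree_meanB).
rewrite tree_meanS -tree_meanZ; apply: eq_tree_mean => s sm; congr (_ * _).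
set Y := nb_covered R (parent s) m.+1; set W := nb_covered2 R (parent s) m.+1.
pose A k j : R := (in_subtree (parent s) m.+1 k j)%:R.
have sumA k : \sum_(j < m.+1) A k j = Y k by [].
have sumAA k l : \sum_(j < m.+1) A k j * A l j = W k l.
  by apply: eq_bigr => j _; rewrite -natrM mulnb.
under eq_bigr => j _.
  rewrite !nb_covered_rcons // -/Y -!/(A _ j).
  have -> : (Y a.+1 + a.+1%:R * (A a j - A a.+1 j)) *
            (Y b.+1 + b.+1%:R * (A b j - A b.+1 j)) =
    Y a.+1 * Y b.+1 + (Y b.+1 * a.+1%:R) * A a j - (Y b.+1 * a.+1%:R) * A a.+1 j
    + (Y a.+1 * b.+1%:R) * A b j - (Y a.+1 * b.+1%:R) * A b.+1 j
    + (a.+1%:R * b.+1%:R) * (A a j * A b j)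
    - (a.+1%:R * b.+1%:R) * (A a j * A b.+1 j)
    - (a.+1%:R * b.+1%:R) * (A a.+1 j * A b j)
    + (a.+1%:R * b.+1%:R) * (A a.+1 j * A b.+1 j) by ring.
  over.
rewrite !(big_split, sumrN) /= -!mulr_sumr !sumA !sumAA sumr_const card_ord.
ring.
Qed.

(** * Closed forms for the mean values *)

(** In the step from [m] to [m.+1] at [k = m.+1], the induction hypothesis says
    nothing about [mean_covered m k], but the coefficient of that term is zero. *)
Lemma mean_coveredE m k : (k <= m)%N -> mean_covered m k = m.+1%:R / k.+1%:R.
Proof.
have mean0 i : mean_covered i 0 = i.+1%:R.
  by rewrite /mean_covered (eq_tree_mean (fun s _ => nb_covered0 _ _ _)) tree_mean_cst.
elim: m k => [|m IH] [|k] // le_km; rewrite ?mean0 ?divr1 //.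
rewrite mean_coveredS (IH k) //.
have -> : (m.+1%:R - k.+1%:R) * mean_covered m k.+1 =
          (m.+1%:R - k.+1%:R) * (m.+1%:R / k.+2%:R).
  move: le_km; rewrite leq_eqVlt => /predU1P[[->]|lt_km]; first by rewrite subrr !mul0r.
  by rewrite IH.
rewrite -!natr1; field.
by rewrite !natr1 !pnatr_eq0.
Qed.

Lemma mean_covered2E m a b : (a < b <= m)%N ->
  mean_covered2 m a b = m.+1%:R / (a.+1%:R * b.+1%:R).
Proof.
elim: m a b => [|m IH] a [|b] /andP[lt_ab le_bm] //.
case: a lt_ab => [|a] lt_ab.
  by rewrite -[LHS]/(mean_covered _ _) mean_coveredE // mul1r.
rewrite mean_covered2S // (IH a b); last by apply/andP; split.
have -> : (m.+1%:R - b.+1%:R) * mean_covered2 m a.+1 b.+1 =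
          (m.+1%:R - b.+1%:R) * (m.+1%:R / (a.+2%:R * b.+2%:R)).
  move: le_bm; rewrite leq_eqVlt => /predU1P[[->]|lt_bm]; first by rewrite subrr !mul0r.
  by rewrite IH ?lt_ab.
have -> : (b%:R - a.+1%:R) * mean_covered2 m a.+1 b =
          (b%:R - a.+1%:R) * (m.+1%:R / (a.+2%:R * b.+1%:R)).
  move: lt_ab; rewrite leq_eqVlt => /predU1P[[->]|lt_ab]; first by rewrite subrr !mul0r.
  by rewrite IH //; apply/andP; split.
rewrite -!natr1; field.
by rewrite !natr1 !pnatr_eq0.
Qed.

Lemma mean_covered2C m a b : mean_covered2 m a b = mean_covered2 m b a.
Proof. by apply: eq_tree_mean => s _; rewrite nb_covered2C. Qed.

Lemma mean_coveredMC m a b : mean_coveredM m a b = mean_coveredM m b a.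
Proof. by apply: eq_tree_mean => s _; rewrite mulrC. Qed.

Lemma mean_coveredM0 m a : (a <= m)%N -> mean_coveredM m a 0 = m.+1%:R ^+ 2 / a.+1%:R.
Proof.
move=> le_am; rewrite expr2 -mulrA -mean_coveredE // -tree_meanZ.
by apply: eq_tree_mean => s _; rewrite nb_covered0 mulrC.
Qed.


(** The probability that a uniformly random node lies both in a subtree of size
    [a] and in one of size [b]; it does not depend on the number of nodes once
    this exceeds [a] and [b]. *)
Definition joint_covered (a b : nat) : R :=
  if a == b then a.+1%:R^-1 else (a.+1%:R * b.+1%:R)^-1.

(** The covariance of the numbers of covered nodes, per node of the tree; dividing
    it by [a b] gives [sigma_hat]. *)
Definition cov_covered (a b : nat) : R :=
  if a == b then a%:R * (2 * a%:R ^+ 2 - 1) / (a.+1%:R ^+ 2 * a.*2.+1%:R)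
  else - (minn a b)%:R / ((maxn a b).+1%:R * (a + b).+1%:R).

Lemma joint_coveredC a b : joint_covered a b = joint_covered b a.
Proof. by rewrite /joint_covered eq_sym mulrC; case: eqVneq => // ->. Qed.

Lemma cov_coveredC a b : cov_covered a b = cov_covered b a.
Proof. by rewrite /cov_covered eq_sym minnC maxnC addnC; case: eqVneq => // ->. Qed.

Lemma joint_covered_diag a : joint_covered a a = a.+1%:R^-1.
Proof. by rewrite /joint_covered eqxx. Qed.

Lemma joint_covered_gt a b : (b < a)%N -> joint_covered a b = (a.+1%:R * b.+1%:R)^-1.
Proof. by move=> lt_ba; rewrite /joint_covered gtn_eqF. Qed.

Lemma cov_covered_diag a :
  cov_covered a a = a%:R * (2 * a%:R ^+ 2 - 1) / (a.+1%:R ^+ 2 * a.*2.+1%:R).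
Proof. by rewrite /cov_covered eqxx. Qed.

Lemma cov_covered_gt a b : (b < a)%N ->
  cov_covered a b = - b%:R / (a.+1%:R * (a + b).+1%:R).
Proof.
move=> lt_ba; rewrite /cov_covered gtn_eqF //.
by rewrite (minn_idPr (ltnW lt_ba)) (maxn_idPl (ltnW lt_ba)).
Qed.

Lemma cov_covered0 a : cov_covered a 0 = 0.
Proof.
rewrite /cov_covered minn0 oppr0 mul0r.
by case: eqVneq => // ->; rewrite !mul0r.
Qed.

Lemma mean_covered2_joint m a b : (a <= m)%N -> (b <= m)%N ->
  mean_covered2 m a b = m.+1%:R * joint_covered a b.
Proof.
move=> le_am le_bm; rewrite /joint_covered; case: ltngtP => [lt_ab|lt_ba|<-].
- by rewrite mean_covered2E ?lt_ab.
- by rewrite mean_covered2C mean_covered2E ?lt_ba // [_ * a.+1%:R]mulrC.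
rewrite -mean_coveredE //; apply: eq_tree_mean => s _.
by rewrite nb_covered2_diag.
Qed.

(** What remains of the recurrence for [mean_coveredM] once the terms of higher
    order in the number of nodes cancel.  The cases [a = b] and [a = b.+1] are
    apart because there the diagonal values occur on either side. *)
Lemma cov_covered_rec a b :
  a.+1%:R * cov_covered a b.+1 + b.+1%:R * cov_covered a.+1 b
  + a.+1%:R * b.+1%:R * (joint_covered a b - joint_covered a b.+1
                         - joint_covered a.+1 b + joint_covered a.+1 b.+1) =
  (a.+2%:R * b.+2%:R)^-1 + (a + b).+3%:R * cov_covered a.+1 b.+1.
Proof.
wlog le_ba : a b / (b <= a)%N => [wlog_ba|].
  have [/wlog_ba // | /ltnW/wlog_ba] := leqP b a.
  rewrite [cov_covered b a.+1]cov_coveredC [cov_covered b.+1 a]cov_coveredC.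
  rewrite [cov_covered b.+1 a.+1]cov_coveredC ![joint_covered b _]joint_coveredC.
  rewrite ![joint_covered b.+1 _]joint_coveredC.
  by rewrite [(b + a)%N]addnC [b.+2%:R * _]mulrC => <-; ring.
rewrite leq_eqVlt in le_ba; case/predU1P: le_ba => [<- {a}|].
  rewrite (cov_coveredC b) (joint_coveredC b) !cov_covered_diag !joint_covered_diag.
  rewrite !cov_covered_gt // !joint_covered_gt // doubleS addSn addnn.
  rewrite -!natr1 -!mul2n natrM; field.
  by rewrite -?natrM !natr1 !pnatr_eq0.
rewrite leq_eqVlt => /predU1P[<- {a}|lt_ba].
  rewrite !cov_covered_diag !joint_covered_diag.
  rewrite !cov_covered_gt // !joint_covered_gt // !doubleS !addSn ?addnS addnn.
  rewrite -!natr1 -!mul2n natrM; field.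
  by rewrite -?natrM !natr1 !pnatr_eq0.
have lt_ba' := ltnW lt_ba.
have lt_ba'' := ltnW lt_ba'.
rewrite !cov_covered_gt // ?leqW // !joint_covered_gt // ?leqW //.
rewrite !addSn !addnS -!natr1 natrD.
field.
by rewrite -?natrD !natr1 !pnatr_eq0.
Qed.

(** As for [mean_coveredE], in the step from [m] to [m.+1] at [a + b = m.+1] the
    unknown [mean_coveredM m a b] is multiplied by zero. *)
Lemma mean_coveredME m a b : (a + b <= m)%N ->
  mean_coveredM m a b = m.+1%:R ^+ 2 / (a.+1%:R * b.+1%:R) + m.+1%:R * cov_covered a b.
Proof.
elim: m a b => [|m IH] a [|b]; rewrite ?addn0 => le_abm;
  rewrite ?mean_coveredM0 ?cov_covered0 ?mulr0 ?addr0 ?mulr1 //.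
  by rewrite addnS in le_abm.
case: a le_abm => [|a] le_abm.
  rewrite mean_coveredMC mean_coveredM0 //.
  by rewrite cov_coveredC cov_covered0 mulr0 addr0 mul1r.
rewrite addnS addSn ltnS in le_abm.
have head : (m.+1%:R - a.+1%:R - b.+1%:R) * mean_coveredM m a.+1 b.+1 =
  (m.+1%:R - a.+1%:R - b.+1%:R) *
    (m.+1%:R ^+ 2 / (a.+2%:R * b.+2%:R) + m.+1%:R * cov_covered a.+1 b.+1).
  move: le_abm; rewrite leq_eqVlt => /predU1P[eq_m|lt_abm]; last first.
    by rewrite IH // addnS addSn.
  by rewrite -eq_m -addSn -!natr1 natrD; ring.
rewrite mean_coveredMS head IH ?addnS // IH ?addSn //.
rewrite !mean_covered2_joint; try lia.
have key := cov_covered_rec a b.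
have eq_ab : (a + b).+3%:R = a.+1%:R + b.+1%:R + 1 :> R by rewrite -!natr1 natrD; ring.
have joint : a.+1%:R * b.+1%:R * (joint_covered a b - joint_covered a b.+1
     - joint_covered a.+1 b + joint_covered a.+1 b.+1) =
   (a.+2%:R * b.+2%:R)^-1 + (a.+1%:R + b.+1%:R + 1) * cov_covered a.+1 b.+1
   - a.+1%:R * cov_covered a b.+1 - b.+1%:R * cov_covered a.+1 b.
  by rewrite -eq_ab -key; ring.
rewrite -!mulrBr -mulrDr mulrCA joint -![a.+2%:R]natr1 -![b.+2%:R]natr1 -[m.+2%:R]natr1.
field.
by rewrite !nat1r !natr1 !pnatr_eq0.
Qed.
Lemma tree_mean_nb_subtrees m k : (0 < k <= m)%N ->
  tree_mean m (fun s => nb_subtrees R (parent s) m.+1 k) = m.+1%:R / (k%:R * k.+1%:R).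
Proof.
case/andP=> k_gt0 le_km; have k_neq0 : k%:R != 0 :> R by rewrite pnatr_eq0 -lt0n.
apply: (mulfI k_neq0); rewrite -tree_meanZ invfM mulrCA mulVKf // -mean_coveredE //.
apply: eq_tree_mean => s sm; rewrite nb_covered_subtrees //.
exact: parent_recursive_tree sm.
Qed.

Lemma tree_cov_nb_subtrees m a b : (0 < a)%N -> (0 < b)%N -> (a + b <= m)%N ->
  let X k s : R := nb_subtrees R (parent s) m.+1 k in
  tree_mean m (fun s => (X a s - tree_mean m (X a)) * (X b s - tree_mean m (X b))) =
  m.+1%:R * (cov_covered a b / (a%:R * b%:R)).
Proof.
move=> a_gt0 b_gt0 le_abm X.
have a_neq0 : a%:R != 0 :> R by rewrite pnatr_eq0 -lt0n.
have b_neq0 : b%:R != 0 :> R by rewrite pnatr_eq0 -lt0n.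
have mean_XX : tree_mean m (fun s => X a s * X b s) =
    (a%:R * b%:R)^-1 * mean_coveredM m a b.
  rewrite -tree_meanZ; apply: eq_tree_mean => s sm.
  have hp := parent_recursive_tree sm.
  by rewrite !nb_covered_subtrees // mulrACA mulKf // mulf_neq0.
transitivity (tree_mean m (fun s => X a s * X b s) - tree_mean m (X a) * tree_mean m (X b)).
  set x := tree_mean m (X a); set y := tree_mean m (X b).
  transitivity (tree_mean m (fun s => X a s * X b s - y * X a s - x * X b s + x * y)).
    by apply: eq_tree_mean => s _; ring.
  by rewrite tree_meanD tree_mean_cst !tree_meanB !tree_meanZ -/x -/y; ring.
rewrite mean_XX !tree_mean_nb_subtrees ?mean_coveredME //; try lia.
rewrite -!natr1; field.
by rewrite !natr1 a_neq0 b_neq0 !pnatr_eq0.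
Qed.
End Mean.

(** * Subtrees as sets of descendants *)

Lemma connect_ancestor n (p : nat -> nat) (hp : parent_function p) (u v : 'I_n) :
  connect (child_of (fun i : 'I_n => p i)) u v = ancestor p u v.
Proof.
apply/idP/idP => [/connectP[s]|].
  elim: s u => [|x s IH] u /=; first by move=> _ ->; exact: ancestor_refl.
  case/andP=> /andP[_ /eqP pux] xs /(IH _ xs) xv.
  by rewrite ancestor_step // pux xv orbT.
have [k] := ubnP u; elim: k u => // k IH u; rewrite ltnS => le_uk.
rewrite ancestor_step // => /predU1P[/val_inj <- | ]; first exact: connect0.
have [u0|u_gt0] := posnP u.
  have /eqP p0 : p 0%N == 0%N by rewrite -leqn0 hp.
  rewrite u0 p0 => /(ancestor_leq hp); rewrite leqn0 => /eqP v0.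
  by rewrite (_ : u = v) ?connect0 //; apply: val_inj => /=; rewrite u0 v0.
have lt_pu : (p u < u)%N by apply: leq_ltn_trans (hp u) _; rewrite prednK.
pose x := Ordinal (ltn_trans lt_pu (ltn_ord u)).
move=> xv; apply: (@connect_trans _ _ x); last first.
  by apply: IH => //; apply: leq_trans le_uk.
by apply: connect1; rewrite /child_of /= u_gt0 eqxx.
Qed.

Lemma num_subtrees_nb (R : comNzRingType) n (p : nat -> nat) k :
  parent_function p ->
  (num_subtrees (fun i : 'I_n => p i) k)%:R = nb_subtrees R p n k.
Proof.
move=> hp; rewrite /num_subtrees -sum1_card natr_sum big_mkcond /=.
apply: eq_bigr => v _; rewrite inE.
have -> : #|fringe_subtree (fun i : 'I_n => p i) v| = subtree_size p n v.
  rewrite -sum1_card big_mkcond; apply: eq_bigr => u _.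
  by rewrite inE connect_ancestor //; case: ancestor.
by case: eqP.
Qed.

Lemma eq_num_subtrees n (c c' : 'I_n -> nat) k :
  (forall i : 'I_n, (0 < i)%N -> c i = c' i) -> num_subtrees c k = num_subtrees c' k.
Proof.
move=> cc'; have eq_child : child_of c =2 child_of c'.
  by move=> u v; rewrite /child_of /=; case: posnP => //= /cc' ->.
apply: eq_card => v; rewrite !inE; congr (_ == k); apply: eq_card => u.
by rewrite !inE (eq_connect eq_child).
Qed.

Definition parent_seq m (c : 'I_m.+1 -> nat) : seq nat :=
  mkseq (fun i => c (inord i.+1)) m.

Lemma parent_parent_seq m (c : 'I_m.+1 -> nat) (i : 'I_m.+1) :
  (0 < i)%N -> parent (parent_seq c) i = c i.
Proof.
case: i => -[|i] lt_im //= _; rewrite /parent /= nth_mkseq //.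
by congr c; apply: val_inj; rewrite /= inordK.
Qed.

Lemma parent_seq_eq m (c : 'I_m.+1 -> nat) s : size s = m ->
  parent_seq c = s <-> forall i : 'I_m.+1, (0 < i)%N -> c i = parent s i.
Proof.
move=> szs; split=> [<- i i_gt0|cs]; first by rewrite parent_parent_seq.
apply: (@eq_from_nth _ 0%N); rewrite size_mkseq // => i lt_im.
by rewrite nth_mkseq // cs inordK.
Qed.

(** * The law of the parent sequence *)

Section Law.
Local Open Scope classical_set_scope.
Context (d : measure_display) (T : measurableType d) (R : realType).
Context (P : probability T R) (m : nat) (c : 'I_m.+1 -> {RV P >-> nat}).

Let tree (w : T) := parent_seq (fun i => c i w).

Lemma parent_seq_preimage s : size s = m ->
  tree @^-1` [set s] =
  \bigcap_(i in [set` [set i : 'I_m.+1 | (0 < i)%N]%SET]) (c i @^-1` [set parent s i]).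
Proof.
move=> szs; apply/seteqP; split=> w /=.
  by move/(parent_seq_eq _ szs) => cs i /=; rewrite inE; exact: cs.
by move=> cs; apply/(parent_seq_eq _ szs) => i i_gt0; apply: cs; rewrite /= inE.
Qed.

(** Any set of sequences is allowed since there are only countably many. *)
Lemma measurable_parent_seq (B : set (seq nat)) : measurable (tree @^-1` B).
Proof.
have -> : tree @^-1` B = \bigcup_(s in B) (tree @^-1` [set s]).
  by apply/seteqP; split=> [w Bw|w [s Bs /= ->]] //; exists (tree w).
rewrite bigcup_mkcond.
apply: (@countable_bigcupT_measurable _ _ (seq nat)) => [|s]; first exact: countableP.
case: ifP => // _.
have [szs|szs] := eqVneq (size s) m; last first.
  rewrite (_ : _ @^-1` _ = set0); first exact: measurable0.
  by apply/seteqP; split=> w //= ws; case/eqP: szs; rewrite -ws size_mkseq.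
rewrite parent_seq_preimage //; apply: fin_bigcap_measurable => // i _.
exact: measurable_funPTI.
Qed.

Hypothesis hc : random_recursive_tree c.

Lemma probability_parent_seq s : s \in recursive_trees m ->
  P (tree @^-1` [set s]) = ((m`!%:R)^-1)%:E.
Proof.
move=> sm; have [szs _] := recursive_treesP _ _ sm.
rewrite parent_seq_preimage //; case: hc => unif indep.
rewrite indep //.
have hp := parent_recursive_tree sm.
rewrite (eq_bigr (fun i : 'I_m.+1 => ((i%:R)^-1 : R)%:E)); last first.
  move=> i; rewrite inE => i_gt0.
  have lt_pi : (parent s i < i)%N by apply: leq_ltn_trans (hp i) _; rewrite prednK.
  exact: (unif i (Ordinal (ltn_trans lt_pi (ltn_ord i)))).
rewrite prodEFin; congr EFin.
rewrite prodfV -natr_prod; congr (_%:R^-1).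
rewrite big_mkcond big_ord_recl inE /= mul1n fact_prod big_add1 big_mkord.
by apply: eq_bigr => i _; rewrite inE.
Qed.

(** The events of drawing a given recursive tree are disjoint, and their
    probabilities add up to 1; the integrand is constant on each. *)
Lemma expectation_parent_seq (F : seq nat -> R) :
  ('E_P[F \o tree] = (tree_mean m F)%:E)%E.
Proof.
pose D := \big[setU/set0]_(s <- recursive_trees m) (tree @^-1` [set s]).
have mE s : measurable (tree @^-1` [set s]) by exact: measurable_parent_seq.
have mD : measurable D by apply: bigsetU_measurable.
have mF (G : seq nat -> R) A : measurable A -> measurable_fun A (G \o tree).
  move=> mA _ Y _.
  by apply: measurableI => //; exact: (measurable_parent_seq (G @^-1` Y)).
have intD (G : seq nat -> R) : (\int[P]_(w in D) (G (tree w))%:E = (tree_mean m G)%:E)%E.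
  rewrite /D (@integral_bigsetU_EFin _ _ _ P _ _ (G \o tree)) //; last exact/measurable_EFinP/mF.
  - rewrite /tree_mean mulr_sumr -sumEFin; apply: eq_big_seq => s sm.
    rewrite (eq_integral (cst (G s)%:E)); last by move=> w /set_mem /= ->.
    by rewrite integral_cst // [X in (_ * X)%E](probability_parent_seq sm) -EFinM mulrC.
  - exact: recursive_trees_uniq.
  - by move=> s t _ _ [w [/= <- <-]].
(* Integrating the constant 1 over D gives its measure. *)
have PD : P D = 1%E.
  by have := intD (fun=> 1); rewrite tree_mean_cst integral_cst // mul1e.
rewrite unlock -(setUv D) integral_setU //; last 3 first.
- exact: measurableC.
- by rewrite setUv; exact/measurable_EFinP/mF.
- by apply/disj_setPLR; rewrite setCK.
rewrite intD null_set_integral ?adde0 //; first exact: measurableC.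
- by apply/measurable_EFinP/mF; exact: measurableC.
- by have := probability_setC P mD; rewrite PD subee.
Qed.
End Law.

(** * The covariance of the subtree counts *)

Lemma sigma_hat_cov_covered (R : realType) (a b : nat) : (0 < a)%N -> (0 < b)%N ->
  cov_covered R a b / (a%:R * b%:R) = sigma_hat R a b.
Proof.
move=> a_gt0 b_gt0.
have a_neq0 : a%:R != 0 :> R by rewrite pnatr_eq0 -lt0n.
have b_neq0 : b%:R != 0 :> R by rewrite pnatr_eq0 -lt0n.
rewrite /sigma_hat /sigma_hat_gt; case: ltngtP => [lt_ba|lt_ab|<-].
- rewrite cov_covered_gt // -!natr1 natrD; field.
  by rewrite a_neq0 b_neq0 -natrD !natr1 !pnatr_eq0.
- rewrite cov_coveredC cov_covered_gt // -!natr1 natrD; field.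
  by rewrite a_neq0 b_neq0 -natrD !natr1 !pnatr_eq0.
rewrite cov_covered_diag -!natr1 -mul2n natrM; field.
by rewrite b_neq0 -natrM !natr1 !pnatr_eq0.
Qed.

Theorem theorem1p15 (d : measure_display) (T : measurableType d) (R : realType)
    (P : probability T R) (k m n : nat) (c : 'I_n -> {RV P >-> nat})
    (hk : (1 <= k)%N) (hm : (1 <= m)%N) (hn : (k + m < n)%N)
    (hc : random_recursive_tree c) :
  covariance P (subtree_count c k) (subtree_count c m) =
    (n%:R * sigma_hat R k m)%:E.
Proof.
case: n c hn hc => // n c hn hc.
pose X l s : R := nb_subtrees R (parent s) n.+1 l.
pose count l (s : seq nat) : R := (num_subtrees (fun i : 'I_n.+1 => parent s i) l)%:R.
pose tree w := parent_seq (fun i => c i w).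
have countE l : subtree_count c l = count l \o tree.
  apply/funext => w; congr (_%:R); apply: eq_num_subtrees => i i_gt0.
  by rewrite parent_parent_seq.
have countX l : {in recursive_trees n, count l =1 X l}.
  by move=> s /parent_recursive_tree hp; apply: num_subtrees_nb.
have EX l : fine ('E_P[subtree_count c l])%E = tree_mean n (X l).
  by rewrite countE expectation_parent_seq //= (eq_tree_mean (countX l)).
rewrite unlock !EX !countE.
rewrite (_ : (_ * _)%R = (fun s => (count k s - tree_mean n (X k)) *
    (count m s - tree_mean n (X m))) \o tree) //.
rewrite expectation_parent_seq //; congr EFin.
rewrite -sigma_hat_cov_covered // -tree_cov_nb_subtrees //.
by apply: eq_tree_mean => s sm; rewrite !countX.
Qed.
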